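(* For every integer $e\ge 3$ there exists $\varepsilon=\varepsilon(e)>0$ such that $$f(n,\, e+\lfloor \log_2 e\rfloor+38,\, e)=O(n^{2-\varepsilon}),$$ i.e. there is a constant $C=C(e)$ such that every $3$-uniform hypergraph on $n$ vertices with more than $C n^{2-\varepsilon}$ edges contains a set of at most $e+\lfloor \log_2 e\rfloor+38$ vertices spanning at least $e$ edges.
   Context: For integers $n,v,e$, a $(v,e)$-configuration is a $3$-uniform hypergraph with at most $v$ vertices and at least $e$ edges. $f(n,v,e)$ denotes the maximum number of edges in a $3$-uniform hypergraph on $n$ vertices which does not contain a $(v,e)$-configuration as a subhypergraph. *)

(* Defs.v *)
From HB Require Import structures.
From mathcomp Require Import all_boot all_order all_algebra.
From mathcomp Require Import all_classical all_reals all_analysis.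

Set Implicit Arguments.
Unset Strict Implicit.
Unset Printing Implicit Defensive.

(* A hypergraph on the vertex set [T] is given by its set of edges. *)
Definition uniform3 (T : finType) (E : {set {set T}}) : bool :=
  [forall h in E, #|h| == 3].

(* A subhypergraph is a pair of a vertex set [S] and a set [F] of edges, each
   contained in [S]; 3-uniformity of [F] is inherited from [E]. *)
Definition has_configuration (v e : nat) (T : finType) (E : {set {set T}}) :
    bool :=
  [exists S : {set T}, exists F : {set {set T}},
    [&& F \subset E, F \subset powerset S, #|S| <= v & e <= #|F|]].

Definition fBES (n v e : nat) : nat :=
  \max_(E : {set {set 'I_n}} | uniform3 E && ~~ has_configuration v e E) #|E|.

(* Main.v *)
(* Call the excess of a 3-uniform pattern its number of vertices minus its
   number of edges.  A pattern with e edges, excess d and a set S of d - 1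
   vertices is doubled by taking two copies of it that share exactly S: the
   number of edges doubles and the excess grows by 1, so k doublings of a single
   edge give 2^k edges with excess k + 2.

   Let N be the number of copies of the pattern in a host with n vertices.  By
   Cauchy-Schwarz at least N^2 / n^(d-1) pairs of copies agree on S.  If most of
   these pairs share an edge, then many copies agree on S and on a further edge;
   they contain a sunflower whose kernel K, by the sparsity condition
   |S u V(D)| >= |D| + d for all D <> 0, has excess at least d.  Each petal then
   has at least as many edges as new vertices, so that arbitrarily many edges
   are obtained with excess d.  Otherwise the number of copies of the doubled
   pattern is of order N^2 / n^(d-1), and starting from m edges one gets about
   m^(2^k) / n^(2^(k+1)-k-2) copies after k steps.  This stays large enough to
   continue as soon as m >= C n^(2-2^(-k)).

   The doubling can be iterated because a pattern carries two disjoint sets S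
   and A with the same properties: after gluing along S, the set consisting of
   the left copy of A and a vertex b outside S and A of the right copy, together
   with its mirror image, is the new pair. *)
Require Import Defs.
From mathcomp Require Import all_boot zify.

Set Implicit Arguments.
Unset Strict Implicit.
Unset Printing Implicit Defensive.

(** * Unions, ordered triples and their images *)

Lemma card_setUD (T : finType) (A B : {set T}) :
  #|A :|: B| = #|A| + #|B :\: A|.
Proof.
rewrite cardsU cardsD setIC -addnBA //; exact/subset_leq_card/subsetIl.
Qed.

Lemma leq_card_bigcup (I T : finType) (P : pred I) (F : I -> {set T}) :
  #|\bigcup_(i | P i) F i| <= \sum_(i | P i) #|F i|.
Proof.
elim/big_rec2: _ => [|i n A _ leA]; first by rewrite cards0.
by rewrite (leq_trans (leq_card_setU _ _)) // leq_add2l.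
Qed.

Section Triples.
Variables V T : finType.
Implicit Types (t : V * V * V) (phi : V -> T).

(** Edges are ordered triples: a vertex map acts on them coordinatewise, and two maps with the same
    image of a triple agree at each of its vertices, which fails for images of sets. *)
Definition tset t : {set V} := [set t.1.1; t.1.2; t.2].

Definition tmap phi t : T * T * T := (phi t.1.1, phi t.1.2, phi t.2).

End Triples.

Lemma tset_map (V T : finType) (phi : V -> T) (t : V * V * V) :
  tset (tmap phi t) = phi @: tset t.
Proof. by rewrite /tset !imsetU !imset_set1. Qed.

Lemma tmap_comp (U V T : finType) (phi : V -> T) (g : U -> V) (t : U * U * U) :
  tmap phi (tmap g t) = tmap (phi \o g) t.
Proof. by []. Qed.

Lemma eq_tmap (V T : finType) (phi psi : V -> T) (t : V * V * V) :
  {in tset t, phi =1 psi} -> tmap phi t = tmap psi t.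
Proof.
by case: t => [[x y] z] e; rewrite /tmap /= !e // !inE /= eqxx ?orbT.
Qed.

Lemma tmap_eq (V T : finType) (phi psi : V -> T) (t : V * V * V) :
  tmap phi t = tmap psi t -> {in tset t, phi =1 psi}.
Proof.
case: t => [[x y] z] [ex ey ez] v; rewrite !inE /=.
by case/orP => [/orP [] |] /eqP ->.
Qed.

Definition hosts (v e : nat) (T : finType) (O : {set T * T * T}) : Prop :=
  exists U : {set T}, #|U| <= v /\ e <= #|[set t in O | tset t \subset U]|.

Lemma hostsW v v' e (T : finType) (O : {set T * T * T}) :
  v <= v' -> hosts v e O -> hosts v' e O.
Proof. by move=> le_v [U [Uv Ue]]; exists U; rewrite (leq_trans Uv). Qed.

(** * Patterns, forward listings and copies in a host *)

Section Patterns.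
Variables (V E : finType) (ed : E -> V * V * V).
Implicit Types (D : {set E}) (W S : {set V}).

Definition span D : {set V} := \bigcup_(f in D) tset (ed f).

Lemma span0 : span set0 = set0.
Proof. exact: big_set0. Qed.

Lemma span1 f : span [set f] = tset (ed f).
Proof. exact: big_set1. Qed.

Lemma spanU D D' : span (D :|: D') = span D :|: span D'.
Proof. exact: bigcup_setU. Qed.

Lemma sub_span f D : f \in D -> tset (ed f) \subset span D.
Proof. by move=> fD; apply: (bigcup_sup f). Qed.

(* From [W] the edges can be listed so that each one adds at most one new
   vertex; phrasing this for every [D] lets the list start from any edge set. *)
Definition forward W : Prop := forall D, D != setT ->
  exists2 f, f \notin D & #|tset (ed f) :\: (W :|: span D)| <= 1.

Lemma forward_extend W D r : forward W -> #|D| + r <= #|E| ->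
  exists D', [/\ D \subset D', #|D'| = #|D| + r
               & #|W :|: span D'| <= #|W :|: span D| + r].
Proof.
move=> fW; elim: r => [|r IHr] le_E; first by exists D; rewrite !addn0.
have [|D1 [sD cD le1]] := IHr; first by lia.
have [|f fD lef] := fW D1.
  by apply: contraTneq le_E => D1T; rewrite -ltnNge addnS -cD D1T cardsT.
exists (f |: D1); split.
- by rewrite (subset_trans sD) // subsetUr.
- by rewrite cardsU1 fD cD; lia.
rewrite spanU span1 setUCA setUC card_setUD.
by rewrite addnS -addn1 leq_add.
Qed.

Variables (T : finType) (O : {set T * T * T}).
Implicit Types (phi psi : {ffun V -> T}) (Phi : {set {ffun V -> T}}).

(** Only edges have to stay distinct. Vertices may be identified, which can only lower the number of
    vertices spanned in the host. *)
Definition copies : {set {ffun V -> T}} :=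
  [set phi : {ffun V -> T} | [forall f, tmap phi (ed f) \in O]
     && injectiveb (fun f => tmap phi (ed f))].

Lemma copiesP phi : reflect
  ((forall f, tmap phi (ed f) \in O) /\ injective (fun f => tmap phi (ed f)))
  (phi \in copies).
Proof.
rewrite inE; apply: (iffP andP) => [[/forallP ? /injectiveP] | [? ?]] //.
by split; [apply/forallP | apply/injectiveP].
Qed.

(** A forward listing can be stopped after exactly [e] edges, so a copy of any larger pattern is
    good enough. *)
Lemma copy_hosts phi W e : phi \in copies -> forward W -> e <= #|E| ->
  hosts (#|W| + e) e O.
Proof.
move=> /copiesP [phiO phi_inj] fW le_e.
have [|D [_ cD leD]] := @forward_extend W set0 e fW; first by rewrite cards0.
rewrite cards0 add0n in cD; rewrite span0 setU0 in leD.
exists (phi @: span D); split.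
  apply: leq_trans (leq_imset_card _ _) (leq_trans _ leD).
  exact/subset_leq_card/subsetUr.
rewrite -{1}cD -(card_imset D phi_inj); apply: subset_leq_card.
apply/subsetP => _ /imsetP [f fD ->].
by rewrite inE phiO tset_map imsetS // sub_span.
Qed.

(** Edges of [D] are exempt because the copies to be compared agree on [span D]. *)
Definition clash D phi psi : bool :=
  [exists f, exists g, [&& f \notin D, g \notin D
     & tmap phi (ed f) == tmap psi (ed g)]].

End Patterns.

(** * Sunflowers of copies *)

(** Greedy choice: each element picked discards at most [c] candidates. *)
Lemma independent_seq (X : finType) (r : rel X) c k (Y : {set X}) :
  (forall x, x \in Y -> #|[set y in Y | r x y]| <= c) -> k * c < #|Y| ->
  exists s : seq X, [/\ size s = k.+1, {subset s <= Y}
                       & pairwise (fun x y => ~~ r x y) s].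
Proof.
elim: k Y => [|k IHk] Y rY ltY.
  have /card_gt0P [x xY] : 0 < #|Y| by lia.
  by exists [:: x]; split=> // y; rewrite inE => /eqP ->.
have /card_gt0P [x xY] : 0 < #|Y| by lia.
have [||s [ss sY ps]] := IHk (Y :\: [set y in Y | r x y]).
- move=> y /setDP [yY _]; apply: leq_trans (rY y yY); apply: subset_leq_card.
  by apply/subsetP => z; rewrite !inE => /andP [/andP [_ ->] ->].
- have := rY x xY; have := cardsD Y [set y in Y | r x y].
  have := subset_leq_card (subsetIr Y [set y in Y | r x y]).
  rewrite mulSn in ltY; lia.
exists (x :: s); split=> /=; first by rewrite ss.
  by move=> y; rewrite inE => /orP [/eqP -> //| /sY /setDP []].
rewrite ps andbT; apply/allP => y /sY; rewrite !inE => /andP [+ yY].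
by rewrite yY.
Qed.

Section Sunflower.
Variables (V E : finType) (ed : E -> V * V * V).
Variables (T : finType) (O : {set T * T * T}).
Variables (D : {set E}) (K : {set V}) (phi0 : {ffun V -> T}).
Hypotheses (phi0C : phi0 \in copies ed O) (spanD : span ed D \subset K).

(* [K] is the kernel of a sunflower with petals [L], which all agree with [phi0]
   on [K]. *)
Definition bunch (L : seq {ffun V -> T}) (q u : nat) : Prop :=
  exists (U : {set T}) (Q : {set T * T * T}),
  [/\ #|Q| = q, #|U| <= u, Q \subset [set t in O | tset t \subset U],
      phi0 @: K \subset U
    & forall t, t \in Q ->
        (exists2 g, g \in D & t = tmap phi0 (ed g)) \/
        (exists2 psi, psi \in L & exists2 g, g \notin D & t = tmap psi (ed g))].

Lemma bunch_nil : bunch [::] #|D| #|K|.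
Proof.
have /copiesP [phiO phi_inj] := phi0C.
exists (phi0 @: K), [set tmap phi0 (ed g) | g in D]; split=> //.
- by rewrite card_imset.
- exact: leq_imset_card.
- apply/subsetP => _ /imsetP [g gD ->]; rewrite inE phiO tset_map imsetS //.
  exact: subset_trans (sub_span ed gD) spanD.
by move=> _ /imsetP [g gD ->]; left; exists g.
Qed.

(** The new triples avoid [Q]: those of the kernel because [phi] is injective on edges, those of the
    other petals because nothing clashes. A proper subset [D'] yields a partial petal. *)
Lemma bunch_cons phi L q u (D' : {set E}) (X : {set V}) :
    phi \in copies ed O -> {in K, phi =1 phi0} ->
    all (fun psi => ~~ clash ed D phi psi) L ->
    span ed D' \subset X -> bunch L q u ->
  bunch (phi :: L) (q + #|D' :\: D|) (u + #|X :\: K|).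
Proof.
move=> /copiesP [phiO phi_inj] eqK /allP nclash spanX [U [Q [cQ cU sQ sU QL]]].
set N := [set tmap phi (ed f) | f in D' :\: D].
exists (U :|: phi @: (X :\: K)), (Q :|: N); split.
- rewrite cardsU disjoint_setI0 ?cards0 ?subn0 ?cQ ?card_imset //.
  apply/pred0P => t /=; apply/negbTE/negP => /andP [/QL tQ /imsetP [f]].
  rewrite inE => /andP [fD _] def_t; case: tQ => [[g gD] | [psi psiL [g gD]]].
    rewrite def_t -(@eq_tmap _ _ phi) => [/phi_inj fg | v gv].
      by rewrite fg gD in fD.
    by apply: eqK; apply: (subsetP spanD); apply: (subsetP (sub_span ed gD)).
  move=> eq_t; case/negP: (nclash _ psiL).
  by apply/existsP; exists f; apply/existsP; exists g; rewrite fD gD -def_t eq_t /=.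
- by rewrite (leq_trans (leq_card_setU _ _)) // leq_add // leq_imset_card.
- rewrite subUset; apply/andP; split.
    apply: subset_trans sQ _; apply/subsetP => t; rewrite !inE => /andP [-> tU].
    by rewrite (subset_trans tU) ?subsetUl.
  apply/subsetP => _ /imsetP [f fD ->]; rewrite inE phiO tset_map /=.
  apply/subsetP => _ /imsetP [v vf ->]; rewrite inE.
  have vX: v \in X.
    apply: (subsetP spanX); apply: (subsetP (sub_span ed _)) vf.
    by case/setDP: fD.
  have [vK | vK] := boolP (v \in K).
    by rewrite eqK // (subsetP sU) // imset_f.
  by rewrite (imset_f phi) ?orbT // inE vK.
- by rewrite (subset_trans sU) ?subsetUl.
move=> t /setUP [/QL [] | /imsetP [f /setDP [_ fD] ->]]; first by left.
  move=> [psi psiL gt]; right; exists psi => //; by rewrite inE psiL orbT.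
by right; exists phi; [rewrite inE eqxx | exists f].
Qed.

Lemma bunch_all L : {subset L <= copies ed O} ->
    {in L, forall phi : {ffun V -> T}, {in K, phi =1 phi0}} ->
    pairwise (fun phi psi => ~~ clash ed D phi psi) L ->
  bunch L (#|D| + size L * #|~: D|) (#|K| + size L * #|~: K|).
Proof.
elim: L => [|phi L IHL] LC LK /=; first by rewrite !mul0n !addn0 => _; exact: bunch_nil.
case/andP => phiL pL; rewrite !mulSn (addnC #|~: D|) (addnC #|~: K|) !addnA.
rewrite -[~: D]setTD -[~: K]setTD.
apply: bunch_cons; rewrite ?subsetT ?setTD //.
- by apply: LC; rewrite inE eqxx.
- by apply: LK; rewrite inE eqxx.
by apply: IHL => // psi psiL; [apply: LC | apply: LK]; rewrite inE psiL orbT.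
Qed.

End Sunflower.

(** Kernel and first full petal form one whole copy, with [k + a + d] vertices. As [w' <= a], each
    further full petal has at most as many new vertices as edges, and the partial one has at most
    [r + 1]. Without a full petal the kernel size [w] would not be controlled, hence [0 < m]. *)
Lemma sunflower_arith (k a m r d e w w' x y z : nat) : 0 < m ->
    e = k + (m * a + r) -> k + d <= w -> w + w' = k + a + d ->
    x + w = y -> y <= z + r -> z <= w.+1 ->
  w + m * w' + x <= (e + d).+1.
Proof.
case: m => // m _ -> lew eqw eqy ley lez; rewrite !mulSn.
have : m * w' <= m * a by rewrite leq_mul2l; apply/orP; right; lia.
lia.
Qed.

(* The number of maps that suffices is found by induction on the number [j] of
   edges outside the kernel: either many copies agree on one more edge, or they
   contain a sunflower.  Listing the edges of the last, partial petal from [b]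
   costs the extra vertex. *)
Lemma sunflower_hosts (V E : finType) (ed : E -> V * V * V) (d : nat)
    (S : {set V}) (b : V) (e : nat) :
    #|V| = #|E| + d ->
    (forall D, D != set0 -> #|D| + d <= #|S :|: span ed D|) ->
    forward ed (b |: S) -> span ed setT = setT -> #|E| <= e ->
  forall j, exists M, forall (T : finType) (O : {set T * T * T}) (D : {set E})
      (Phi : {set {ffun V -> T}}),
    D != set0 -> #|~: D| = j -> Phi \subset copies ed O ->
    {in Phi &, forall phi psi : {ffun V -> T}, {in S :|: span ed D, phi =1 psi}} ->
    M <= #|Phi| -> hosts (e + d).+1 e O.
Proof.
move=> cardV sparseS fS spanT le_e; elim=> [|j [M IHj]].
  exists 2 => T O D Phi _ /eqP; rewrite cards_eq0 => /eqP DT _ eqPhi.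
  have {}DT : D = setT by rewrite -[D]setCK DT setC0.
  case/card_gt1P => phi [psi [phiP psiP /eqP []]].
  by apply/ffunP => v; apply: eqPhi => //; rewrite DT spanT !inE orbT.
(* A copy clashes with at most [M] copies per pair of edges, and at most [e + 1] copies are to be
   picked greedily. *)
exists (e * (#|E| * #|E| * M)).+1 => T O D Phi Dn0 cD PhiC eqPhi lePhi.
case: (boolP [exists f, exists t, (f \notin D)
    && (M <= #|[set phi in Phi | tmap phi (ed f) == t]|)]).
  case/existsP => f /existsP [t /andP [fD leM]].
  apply: (IHj T O (f |: D) [set phi in Phi | tmap phi (ed f) == t]) leM.
  - by apply/set0Pn; exists f; rewrite setU11.
  - have := cardsC D; have := cardsC (f |: D); rewrite cardsU1 fD; lia.
  - by apply: subset_trans PhiC; apply/subsetP => phi; rewrite inE => /andP [].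
  move=> phi psi; rewrite !inE => /andP [phiP /eqP ephi] /andP [psiP /eqP epsi].
  move=> v; rewrite spanU span1 setUCA inE => /orP [vf | vD].
    by apply: tmap_eq vf; rewrite ephi epsi.
  exact: eqPhi.
move/existsPn => fewM.
have {}fewM f t : f \notin D -> #|[set phi in Phi | tmap phi (ed f) == t]| <= M.
  move=> fD; move/existsPn: (fewM f) => /(_ t).
  by rewrite fD /= -ltnNge => /ltnW.
have few_clash phi : phi \in Phi ->
    #|[set psi in Phi | clash ed D phi psi]| <= #|E| * #|E| * M.
  move=> phiP.
  apply: (@leq_trans #|\bigcup_(fg : E * E | fg.2 \notin D)
     [set psi in Phi | tmap psi (ed fg.2) == tmap phi (ed fg.1)]|).
    apply: subset_leq_card; apply/subsetP => psi; rewrite inE.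
    case/andP => psiP /existsP [f /existsP [g /and3P [fD gD fg]]].
    by apply/bigcupP; exists (f, g) => //; rewrite inE psiP eq_sym.
  rewrite -card_prod -sum_nat_const.
  apply: leq_trans (leq_card_bigcup _ _) _.
  rewrite [leqLHS]big_mkcond /=; apply: leq_sum => fg _.
  by case: ifP => // gD; apply: fewM.
set a := #|~: D|; set k := #|D|.
have a_gt0 : 0 < a by rewrite /a cD.
have cE : k + a = #|E| by apply: cardsC.
(* There are [m] full petals and [r] edges in a partial one; [m] is positive because [#|E| <= e]. *)
have [m [r [def_e r_lt m_gt0 m_le]]] : exists m r,
    [/\ e = k + (m * a + r), r < a, 0 < m & m <= e].
  exists ((e - k) %/ a), ((e - k) %% a); rewrite -divn_eq ltn_mod divn_gt0 //.
  by rewrite (leq_trans (leq_div _ _)) ?leq_subr //; split=> //; lia.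
have [|L0 [sizeL0 subL0 pL0]] :=
  @independent_seq _ (clash ed D) _ m Phi few_clash.
  by apply: leq_trans lePhi; rewrite ltnS leq_mul2r m_le orbT.
clear lePhi few_clash fewM IHj.
(* [phi0] is the reference on the kernel and later supplies the partial petal; the [m] maps in [L]
   supply the full ones. *)
case: L0 sizeL0 subL0 pL0 => [//|phi0 L] [sizeL] subL /= /andP [nclash pL].
have LP psi : psi \in L -> psi \in Phi by move=> psiL; rewrite subL // inE psiL orbT.
have phi0P : phi0 \in Phi by rewrite subL // inE eqxx.
have phi0C := subsetP PhiC _ phi0P.
set K := S :|: span ed D.
have spanD : span ed D \subset K by rewrite subsetUr.
have BL := @bunch_all V E ed T O D K phi0 phi0C spanD L.
have [|D' [sD cD' leD']] := @forward_extend V E ed _ D r fS.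
  by rewrite -cE leq_add2l ltnW.
have {}BL := BL (fun psi psiL => subsetP PhiC _ (LP _ psiL))
  (fun psi psiL => eqPhi _ _ (LP _ psiL) phi0P) pL.
have := bunch_cons spanD phi0C (fun _ _ => erefl) nclash
  (subsetUr (b |: S) (span ed D')) BL.
case=> U [Q [cQ cU sQ _ _]]; exists U; split; last first.
  apply: leq_trans (subset_leq_card sQ).
  by rewrite cQ cardsD (setIidPr sD) cD' sizeL addKn -addnA -def_e.
apply: leq_trans cU _; rewrite sizeL.
have := cardsC K; have := sparseS _ Dn0; rewrite cardV -/K -/k.
have : #|(b |: S) :|: span ed D| <= #|K|.+1.
  by rewrite -setUA cardsU1; case: (_ \notin _).
have : #|((b |: S) :|: span ed D') :\: K| + #|K| = #|b |: S :|: span ed D'|.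
  rewrite addnC -card_setUD; congr #|pred_of_set _|; apply/setUidPr.
  rewrite /K setUSS ?subsetU1 //.
  by apply/bigcupsP => f fD; apply/sub_span/(subsetP sD).
move: leD'; rewrite -/K; set x := #|_ :\: K|; set y := #|b |: S :|: _|.
set z := #|_ :|: span ed D| => h1 h2 h3 h4 h5.
by rewrite -cE in h5; apply: (sunflower_arith m_gt0 def_e h4 h5 h2 h1 h3).
Qed.

(** * Doubling a pattern by gluing along [S] *)

(** [S] is used for the next gluing; [A] is kept in reserve, since its copies make up most of the
    next [S] and [A]. The vertex [s] is shared by both copies after gluing along [S] and becomes the
    next [b]. *)
Record doubling (V E : finType) (ed : E -> V * V * V) (d : nat)
    (S A : {set V}) (b s : V) : Prop := Doubling {
  doubling_card : #|V| = #|E| + d;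
  doubling_cardS : #|S|.+1 = d;
  doubling_cardA : #|A|.+1 = d;
  doubling_disj : [disjoint S & A];
  doubling_bS : b \notin S;
  doubling_bA : b \notin A;
  doubling_sS : s \in S;
  doubling_sparse : forall D, D != set0 -> #|D| + 2 <= #|span ed D|;
  doubling_sparseS : forall D, D != set0 -> #|D| + d <= #|S :|: span ed D|;
  doubling_sparseA : forall D, D != set0 -> #|D| + d <= #|A :|: span ed D|;
  doubling_bS_forward : forward ed (b |: S);
  doubling_bA_forward : forward ed (b |: A);
  doubling_sA_forward : forward ed (s |: A);
  doubling_span : span ed setT = setT }.

(** List the copy given by [i1] from [W]. Once it is complete, the image of [S] is covered, and the
    other copy can be listed from [b |: S]. Abstract maps let the two copies swap roles. *)
Lemma amalgam_forward (V E V' E' : finType) (ed : E -> V * V * V)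
    (ed' : E' -> V' * V' * V') (i1 i2 : V -> V') (j1 j2 : E -> E')
    (S W : {set V}) (b : V) (W' : {set V'}) :
    (forall f, ed' (j1 f) = tmap i1 (ed f)) ->
    (forall f, ed' (j2 f) = tmap i2 (ed f)) ->
    (forall f', (exists f, f' = j1 f) \/ (exists f, f' = j2 f)) ->
    {in S, i1 =1 i2} -> span ed setT = setT ->
    forward ed W -> forward ed (b |: S) ->
    i1 @: W \subset W' -> i2 b \in W' -> forward ed' W'.
Proof.
move=> ed1 ed2 E'P eqS spanT fW fS WW' bW' D' D'T.
have sub1 f v : f \in j1 @^-1: D' -> v \in tset (ed f) -> i1 v \in span ed' D'.
  rewrite inE => fD vf; apply: (subsetP (sub_span ed' fD)).
  by rewrite ed1 tset_map imset_f.
have sub2 f v : f \in j2 @^-1: D' -> v \in tset (ed f) -> i2 v \in span ed' D'.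
  rewrite inE => fD vf; apply: (subsetP (sub_span ed' fD)).
  by rewrite ed2 tset_map imset_f.
have [D1T | D1T] := eqVneq (j1 @^-1: D') setT.
  have [D2T | D2T] := eqVneq (j2 @^-1: D') setT.
    case/eqP: D'T; apply/setP => f'; rewrite inE.
    have [[f ->] | [f ->]] := E'P f'.
      by have := in_setT f; rewrite -D1T inE.
    by have := in_setT f; rewrite -D2T inE.
  have [f fD lef] := fS _ D2T; exists (j2 f); first by rewrite inE in fD.
  apply: leq_trans lef; rewrite ed2 tset_map.
  apply: leq_trans (leq_imset_card i2 _); apply: subset_leq_card.
  apply/subsetP => _ /setDP [/imsetP [v vf ->]]; rewrite inE negb_or => /andP [].
  move=> vW vD; rewrite imset_f // in_setD vf andbT 2!in_setU in_set1 !negb_or -andbA.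
  apply/and3P; split.
  - by apply: contraNneq vW => ->.
  - apply: contra vD => vS; rewrite -eqS //.
    have : v \in span ed setT by rewrite spanT.
    by case/bigcupP => g _; apply: sub1; rewrite D1T.
  by apply: contra vD => /bigcupP [g gD]; apply: sub2.
have [f fD lef] := fW _ D1T; exists (j1 f); first by rewrite inE in fD.
apply: leq_trans lef; rewrite ed1 tset_map.
apply: leq_trans (leq_imset_card i1 _); apply: subset_leq_card.
apply/subsetP => _ /setDP [/imsetP [v vf ->]]; rewrite inE negb_or => /andP [].
move=> vW vD; rewrite imset_f // in_setD vf andbT in_setU negb_or; apply/andP; split.
  by apply: contra vW => vW; apply: (subsetP WW'); rewrite imset_f.
by apply: contra vD => /bigcupP [g gD]; apply: sub1.
Qed.

Section Amalgam.
Variables (V E : finType) (ed : E -> V * V * V) (S : {set V}).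

(** The right copy contributes only its vertices outside [S], which avoids a quotient. *)
Definition amalgam : finType := (V + {x : V | x \notin S})%type.

Definition left_copy (v : V) : amalgam := inl v.

Definition right_copy (v : V) : amalgam :=
  if insub v is Some u then inr u else inl v.

Definition amalgam_ed (f : E + E) : amalgam * amalgam * amalgam :=
  match f with
  | inl g => tmap left_copy (ed g)
  | inr g => tmap right_copy (ed g)
  end.

Lemma left_copy_inj : injective left_copy.
Proof. by move=> u v []. Qed.

Lemma right_copyS v : v \in S -> right_copy v = left_copy v.
Proof. by rewrite /right_copy; case: insubP => // u /negbTE ->. Qed.

Lemma right_copyNS v (vS : v \notin S) : right_copy v = inr (Sub v vS).
Proof. by rewrite /right_copy insubT. Qed.

Lemma right_copy_inj : injective right_copy.
Proof.
move=> u v; rewrite /right_copy.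
case: insubP => [x _ <- | _]; case: insubP => [y _ <- | _] //; last by case.
by case=> ->.
Qed.

Lemma left_right_copy u v : left_copy u = right_copy v -> u = v /\ v \in S.
Proof.
have [vS | vS] := boolP (v \in S); last by rewrite (right_copyNS vS).
by rewrite right_copyS // => - [].
Qed.

Lemma card_amalgam : #|amalgam| + #|S| = #|V| + #|V|.
Proof.
rewrite card_sum card_sig -addnA; congr (_ + _).
by rewrite addnC -(cardsC S) -[in RHS]cardsE; congr (_ + _); apply: eq_card => x; rewrite !inE.
Qed.

Lemma card_copiesU (X Y : {set V}) :
  #|left_copy @: X :|: right_copy @: Y| + #|X :&: Y :&: S| = #|X| + #|Y|.
Proof.
rewrite -(card_imset X left_copy_inj) -(card_imset Y right_copy_inj).
rewrite -(card_imset (_ :&: S) left_copy_inj) -[RHS]cardsUI; congr (_ + #|pred_of_set _|).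
apply/setP => w; rewrite inE; apply/imsetP/andP => [[v] | [/imsetP [u uX ->]]].
  rewrite !inE -andbA => /and3P [vX vY vS] ->; rewrite imset_f //.
  by rewrite -(right_copyS vS) imset_f.
case/imsetP => v vY /left_right_copy [uv vS]; exists u => //.
by rewrite !inE uX uv vY.
Qed.

Lemma span_amalgam (D : {set E + E}) : span amalgam_ed D =
  left_copy @: span ed (inl @^-1: D) :|: right_copy @: span ed (inr @^-1: D).
Proof.
apply/setP => w; apply/bigcupP/setUP => [[[f | f] fD] | []] /=.
- rewrite tset_map => /imsetP [v vf ->]; left; apply: imset_f.
  by apply/bigcupP; exists f; first rewrite inE.
- rewrite tset_map => /imsetP [v vf ->]; right; apply: imset_f.
  by apply/bigcupP; exists f; first rewrite inE.
- case/imsetP => v /bigcupP [f]; rewrite inE => fD vf ->.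
  by exists (inl f); rewrite //= tset_map imset_f.
case/imsetP => v /bigcupP [f]; rewrite inE => fD vf ->.
by exists (inr f); rewrite //= tset_map imset_f.
Qed.

Lemma card_preim_sum (D : {set E + E}) :
  #|D| = #|inl @^-1: D : {set E}| + #|inr @^-1: D : {set E}|.
Proof.
rewrite -(card_imset (inl @^-1: D) (@inl_inj E E)).
rewrite -(card_imset (inr @^-1: D) (@inr_inj E E)) -[RHS]cardsUI.
rewrite [X in _ + #|pred_of_set X|](_ : _ = set0); last first.
  apply/setP => f; rewrite !inE; apply/negP => /andP [/imsetP [g _ ->]].
  by case/imsetP.
rewrite cards0 addn0; apply: eq_card => -[f | f]; rewrite !inE.
  rewrite (mem_imset _ _ (@inl_inj E E)) inE orbC; case: imsetP => // -[] //.
rewrite (mem_imset _ _ (@inr_inj E E)) inE; case: imsetP => // -[] //.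
Qed.

End Amalgam.

Section DoublingStep.
Variables (V E : finType) (ed : E -> V * V * V) (d : nat).
Variables (S A : {set V}) (b s : V).
Hypothesis dbl : doubling ed d S A b s.

Lemma card_spanDS D : D != set0 -> #|D|.+1 <= #|span ed D :\: S|.
Proof.
move=> /(doubling_sparseS dbl); rewrite card_setUD -(doubling_cardS dbl); lia.
Qed.

(** Sparsity over the new gluing sets; the intersection with [S] is what gets identified. If [D1] is
    nonempty, it gives excess [d], and the other side has at least [#|D2| + 1] vertices off [S]. If
    [D1] is empty, [A] misses [S], nothing is identified, and [#|A| = d - 1] adds to the plain
    excess 2 of [D2]. *)
Lemma sparse_crossed D1 D2 : (D1 != set0) || (D2 != set0) ->
  #|D1| + #|D2| + d.+1 + #|(A :|: span ed D1) :&: (b |: span ed D2) :&: S|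
    <= #|A :|: span ed D1| + #|b |: span ed D2|.
Proof.
have [-> /= D2n0 | D1n0 _] := eqVneq D1 set0.
  rewrite span0 setU0 cards0 setIAC [A :&: S]setIC.
  rewrite (disjoint_setI0 (doubling_disj dbl)) set0I cards0.
  have := subset_leq_card (subsetUr [set b] (span ed D2)).
  have := doubling_sparse dbl D2n0; have := doubling_cardA dbl; lia.
have := doubling_sparseA dbl D1n0.
have : #|D2|.+1 <= #|(b |: span ed D2) :\: S|.
  have [-> | /card_spanDS le2] := eqVneq D2 set0.
    rewrite cards0 card_gt0; apply/set0Pn; exists b.
    by rewrite in_setD (doubling_bS dbl) setU11.
  exact: leq_trans le2 (subset_leq_card (setSD _ (subsetUr _ _))).
have := cardsID S (b |: span ed D2).
have : #|(A :|: span ed D1) :&: (b |: span ed D2) :&: S|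
    <= #|(b |: span ed D2) :&: S|.
  by apply: subset_leq_card; rewrite setSI // subsetIr.
lia.
Qed.

Lemma doubling_amalgam :
  doubling (@amalgam_ed V E ed S) d.+1
    (right_copy S b |: left_copy S @: A) (left_copy S b |: right_copy S @: A)
    (left_copy S s) (right_copy S b).
Proof.
have [cV cS cA dSA bS bA sS sp spS spA fSb fAb fAs spT] := dbl.
have neSA v : v \in S -> v \notin A.
  by move=> vS; rewrite (disjointFr dSA).
have EP (f' : E + E) : (exists f, f' = inl f) \/ (exists f, f' = inr f).
  by case: f' => f; [left | right]; exists f.
have EP' (f' : E + E) : (exists f, f' = inr f) \/ (exists f, f' = inl f).
  by case: f' => f; [right | left]; exists f.
have eqS : {in S, left_copy S =1 right_copy S}.
  by move=> v vS; rewrite right_copyS.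
have eqS' : {in S, right_copy S =1 left_copy S}.
  by move=> v vS; rewrite right_copyS.
have bL : right_copy S b \notin left_copy S @: A.
  by apply/imsetP => -[a _ /esym /left_right_copy [_ bS']]; rewrite bS' in bS.
have bR : left_copy S b \notin right_copy S @: A.
  apply/imsetP => -[a aA /left_right_copy [<- bS']]; by rewrite bS' in bS.
have preimN0 (D : {set E + E}) : D != set0 ->
    (inl @^-1: D != set0 :> {set E}) || (inr @^-1: D != set0 :> {set E}).
  by rewrite -!card_gt0 card_preim_sum addn_gt0.
split.
(* The vertex count is [2 * #|V| - #|S| = 2 * #|E| + 2 * d - (d - 1)]. *)
- rewrite [#|{: E + E}|]card_sum; have := card_amalgam S; lia.
- by rewrite cardsU1 bL card_imset ?add1n ?cA //; apply: left_copy_inj.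
- by rewrite cardsU1 bR card_imset ?add1n ?cA //; apply: right_copy_inj.
- rewrite disjoints_subset subUset sub1set !inE; apply/andP; split.
    rewrite negb_or; apply/andP; split.
      by apply/eqP => /esym /left_right_copy [_ bS']; rewrite bS' in bS.
    by rewrite mem_imset //; apply: right_copy_inj.
  apply/subsetP => _ /imsetP [a aA ->]; rewrite !inE negb_or; apply/andP; split.
    by apply: contraNneq bA => /left_copy_inj <-.
  apply/imsetP => -[a' a'A /left_right_copy [_ /neSA]]; by rewrite a'A.
- rewrite !inE negb_or; apply/andP; split.
    by apply/eqP => /left_right_copy [_ bS']; rewrite bS' in bS.
  by rewrite mem_imset ?neSA //; apply: left_copy_inj.
- rewrite !inE negb_or; apply/andP; split.
    by apply: contraNneq bS => /left_copy_inj <-.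
  apply/imsetP => -[a aA /left_right_copy [sa _]].
  by rewrite -sa (negbTE (neSA _ sS)) in aA.
- by rewrite setU11.
- move=> D /preimN0; rewrite card_preim_sum span_amalgam.
  set D1 := _ @^-1: D; set D2 := _ @^-1: D.
  have := card_copiesU S (span ed D1) (span ed D2).
  have [-> | D1n0] := eqVneq D1 set0; have [-> // | D2n0] := eqVneq D2 set0.
  + have := sp _ D2n0.
    by rewrite span0 !set0I !cards0 => ? + _; lia.
  + have := sp _ D1n0.
    by rewrite span0 setI0 set0I !cards0 => ? + _; lia.
  have := sp _ D1n0; have := card_spanDS D2n0; have := cardsID S (span ed D2).
  have : #|span ed D1 :&: span ed D2 :&: S| <= #|span ed D2 :&: S|.
    by apply: subset_leq_card; rewrite setSI // subsetIr.
  by move=> h1 h2 h3 h4 h5 _; lia.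
- move=> D /preimN0 Dn0; rewrite card_preim_sum span_amalgam.
  have := sparse_crossed Dn0; set D1 := _ @^-1: D; set D2 := _ @^-1: D.
  rewrite -(card_copiesU S) !imsetU imset_set1.
  by rewrite leq_add2r [right_copy S b |: _ @: A]setUC setUACA.
- move=> D /preimN0; rewrite orbC => Dn0; rewrite card_preim_sum span_amalgam.
  have := sparse_crossed Dn0; set D2 := _ @^-1: D; set D1 := _ @^-1: D.
  rewrite [#|A :|: _| + _]addnC -(card_copiesU S) !imsetU imset_set1.
  by rewrite [(A :|: _) :&: _]setIC leq_add2r setUACA [#|D1| + _]addnC.
(* The left copy is listed from [s |: A], then the right one from [b] and the shared [S]; next comes
   the mirror image, where both copies of [s] coincide. *)
- apply: (@amalgam_forward _ _ _ _ ed _ (left_copy S) (right_copy S) inl inr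
    S (s |: A) b) => //.
    by rewrite imsetU imset_set1 setUS ?subsetUr.
  by rewrite !inE eqxx orbT.
- apply: (@amalgam_forward _ _ _ _ ed _ (right_copy S) (left_copy S) inr inl
    S (s |: A) b) => //.
    by rewrite imsetU imset_set1 -eqS // setUS ?subsetUr.
  by rewrite !inE eqxx orbT.
(* The new [s] is the right copy of [b]: the right side is listed from [b |: A], then the left one
   from its own [b]. *)
- apply: (@amalgam_forward _ _ _ _ ed _ (right_copy S) (left_copy S) inr inl
    S (b |: A) b) => //.
    by rewrite imsetU imset_set1 setUS ?subsetUr.
  by rewrite !inE eqxx orbT.
rewrite span_amalgam !preimsetT spT; apply/setP => -[v | u]; rewrite !inE.
  by rewrite (imset_f (left_copy S)).
rewrite -[inr u](_ : right_copy S (val u) = _) ?imset_f ?orbT //.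
by rewrite (right_copyNS (valP u)) /=; congr inr; apply: val_inj.
Qed.

End DoublingStep.

(** * Counting copies of the doubled pattern *)

(** Cauchy-Schwarz, by summing [2ab <= a^2 + b^2] over all pairs. *)
Lemma sqr_sum_le (Y : finType) (a : Y -> nat) :
  (\sum_y a y) ^ 2 <= #|Y| * \sum_y a y ^ 2.
Proof.
rewrite -(leq_pmul2l (isT : 0 < 2)) expnS expn1 big_distrlr /= big_distrr /=.
apply: (@leq_trans (\sum_y \sum_z (a y ^ 2 + a z ^ 2))).
  apply: leq_sum => y _; rewrite big_distrr /=; apply: leq_sum => z _.
  exact: nat_Cauchy.
under eq_bigr do rewrite big_split /= sum_nat_const.
by rewrite big_split /= -big_distrr /= sum_nat_const addnn mul2n.
Qed.

Lemma card_collisions (X Y : finType) (B : {set X}) (g : X -> Y) :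
  #|B| ^ 2 <= #|Y| * #|[set p in setX B B | g p.1 == g p.2]|.
Proof.
pose a y := #|[set x in B | g x == y]|.
have -> : #|B| = \sum_y a y.
  rewrite -sum1_card (partition_big g predT) //=; apply: eq_bigr => y _.
  by rewrite /a -sum1_card; apply: eq_bigl => x; rewrite inE.
suff -> : #|[set p in setX B B | g p.1 == g p.2]| = \sum_y a y ^ 2.
  exact: sqr_sum_le.
rewrite -sum1_card (partition_big (fun p => g p.1) predT) //=.
apply: eq_bigr => y _; rewrite expnS expn1 /a -cardsX -sum1_card.
apply: eq_bigl => -[x z]; rewrite !inE /=.
case: (x \in B); case: (z \in B); rewrite /= ?andbF //.
by apply/andP/andP => -[/eqP e1 /eqP e2]; rewrite -?e1 -?e2 ?e1 ?e2 !eqxx.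
Qed.

(** Cauchy-Schwarz bounds from below the pairs of copies that agree on [S]. A pair without a clash
    is a copy of the amalgam. For a clashing pair, the first copy and the two colliding edges fix
    the second copy on [S] and one edge, leaving at most [M] choices. *)
Lemma copies_amalgam (V E : finType) (ed : E -> V * V * V) (S : {set V})
    (T : finType) (O : {set T * T * T}) (M : nat) :
    (forall f (Phi : {set {ffun V -> T}}), Phi \subset copies ed O ->
      {in Phi &, forall phi psi : {ffun V -> T},
        {in S :|: tset (ed f), phi =1 psi}} -> #|Phi| <= M) ->
  #|copies ed O| ^ 2 <= #|T| ^ #|S| *
    (#|copies (@amalgam_ed V E ed S) O| + #|copies ed O| * (#|E| * #|E| * M)).
Proof.
move=> few; set C := copies ed O.
pose g (phi : {ffun V -> T}) := [ffun x : {x : V | x \in S} => phi (val x)].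
have gP (phi psi : {ffun V -> T}) : g phi = g psi -> {in S, phi =1 psi}.
  by move=> /ffunP eqg v vS; have := eqg (Sub v vS); rewrite !ffunE.
have -> : #|T| ^ #|S| = #|{ffun {x : V | x \in S} -> T}|.
  by rewrite card_ffun card_sig.
apply: leq_trans (card_collisions C g) _; rewrite leq_mul2l; apply/orP; right.
set P := [set p in _ | _].
rewrite -(cardsID [set p | clash ed set0 p.1 p.2] P) addnC leq_add //.
  pose h (p : {ffun V -> T} * {ffun V -> T}) : {ffun amalgam S -> T} :=
    [ffun w => match w with inl v => p.1 v | inr u => p.2 (val u) end].
  have hL p v : h p (left_copy S v) = p.1 v by rewrite ffunE.
  have hR p v : p \in P -> h p (right_copy S v) = p.2 v.
    rewrite inE => /andP [_ /eqP /gP eqS]; have [vS | vS] := boolP (v \in S).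
      by rewrite right_copyS // hL eqS.
    by rewrite (right_copyNS vS) ffunE.
  rewrite -(card_in_imset (f := h)) => [|p q /setDP [pP _] /setDP [qP _] eqh].
    apply: subset_leq_card; apply/subsetP => _ /imsetP [p + ->].
    case/setDP => pP; rewrite inE => nclash.
    have hL' f : tmap (h p) (tmap (left_copy S) (ed f)) = tmap p.1 (ed f).
      by rewrite tmap_comp; apply: eq_tmap => v _ /=; rewrite hL.
    have hR' f : tmap (h p) (tmap (right_copy S) (ed f)) = tmap p.2 (ed f).
      by rewrite tmap_comp; apply: eq_tmap => v _ /=; rewrite hR.
    have nclash' f k : tmap p.1 (ed f) <> tmap p.2 (ed k).
      move=> eqfk; case/negP: nclash; apply/existsP; exists f.
      by apply/existsP; exists k; rewrite !inE eqfk /=.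
    have : p \in setX C C by move: pP; rewrite inE => /andP [].
    rewrite inE => /andP [/copiesP [O1 inj1] /copiesP [O2 inj2]].
    apply/copiesP; split=> [[f | f] | [f | f] [k | k]] /=;
      rewrite ?hL' ?hR' //.
    - by move/inj1 ->.
    - by move/nclash'.
    - by move/esym/nclash'.
    by move/inj2 ->.
  rewrite [p]surjective_pairing [q]surjective_pairing; congr pair.
    by apply/ffunP => v; rewrite -hL eqh hL.
  by apply/ffunP => v; rewrite -(hR _ _ pP) eqh hR.
pose F (x : {ffun V -> T} * (E * E)) := [set psi in C |
  (g psi == g x.1) && (tmap psi (ed x.2.2) == tmap x.1 (ed x.2.1))].
have leF x : #|F x| <= M.
  apply: (few x.2.2); first by apply/subsetP => psi; rewrite inE => /andP [].
  move=> phi psi; rewrite !inE => /and3P [_ /eqP g1 /eqP t1].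
  move=> /and3P [_ /eqP g2 /eqP t2] v; rewrite in_setU => /orP [vS | vf].
    by apply: gP vS; rewrite g1.
  by apply: tmap_eq vf; rewrite t1.
apply: (@leq_trans #|\bigcup_(x | x.1 \in C) [set (x.1, psi) | psi in F x]|).
  apply: subset_leq_card; apply/subsetP => -[phi psi].
  rewrite in_setI [in X in _ && X]inE [in X in X && _]inE in_setX /=.
  case/andP => /andP [/andP [phiC psiC] /eqP eqg] /existsP [f /existsP [k]].
  case/and3P => _ _ fk; apply/bigcupP; exists (phi, (f, k)) => //.
  by apply/imsetP; exists psi; rewrite // inE /= psiC eqg eqxx eq_sym.
apply: leq_trans (leq_card_bigcup _ _) _.
apply: (@leq_trans (\sum_(x : {ffun V -> T} * (E * E) | x.1 \in C) M)).
  by apply: leq_sum => x _; rewrite (leq_trans (leq_imset_card _ _)).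
rewrite sum_nat_cond_const -!mulnA leq_eqVlt; apply/orP; left; apply/eqP.
rewrite !mulnA; congr (_ * M); rewrite -mulnA -card_prod -cardsT -cardsX.
by apply: eq_card => x; rewrite !inE andbT.
Qed.

(** * The starting pattern: a single edge *)

Section SingleEdge.

Definition single_ed (f : unit) : 'I_3 * 'I_3 * 'I_3 :=
  (inord 0, inord 1, inord 2).

Lemma ord3P (i : 'I_3) : [|| i == inord 0, i == inord 1 | i == inord 2].
Proof. by case: i => -[|[|[|//]]] lt_i; rewrite -!val_eqE /= !inordK. Qed.

Lemma tset_single f : tset (single_ed f) = setT.
Proof. by apply/setP => i; rewrite !inE /= -orbA ord3P. Qed.

Lemma span_single (D : {set unit}) : D != set0 -> span single_ed D = setT.
Proof.
case/set0Pn => f fD; apply/eqP; rewrite eqEsubset subsetT -(tset_single f).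
exact: sub_span.
Qed.

Lemma forward_single (W : {set 'I_3}) : 1 < #|W| -> forward single_ed W.
Proof.
move=> W2 D DT; exists tt.
  apply: contra DT => ttD; apply/eqP/setP => -[]; by rewrite ttD inE.
rewrite tset_single setTD; have := cardsC (W :|: span single_ed D).
have := subset_leq_card (subsetUl W (span single_ed D)).
rewrite card_ord => le1 eq3; rewrite -(leq_add2l #|W :|: span single_ed D|) eq3.
by rewrite addn1 ltnS (leq_trans W2).
Qed.

Lemma doubling_single : doubling single_ed 2
  [set inord 2] [set inord 0] (inord 1) (inord 2).
Proof.
have ne (i j : nat) : i < 3 -> j < 3 -> (inord i == inord j :> 'I_3) = (i == j).
  by move=> i3 j3; rewrite -val_eqE /= !inordK.
have c1 (D : {set unit}) : #|D| <= 1 by rewrite (leq_trans (max_card _)) ?card_unit.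
split; rewrite ?cards1 ?card_ord ?card_unit ?disjoints1 ?inE ?ne //.
- by move=> D /span_single ->; rewrite cardsT card_ord (leq_add (c1 D) (leqnn 2)).
- by move=> D /span_single ->; rewrite setUT cardsT card_ord (leq_add (c1 D) (leqnn 2)).
- by move=> D /span_single ->; rewrite setUT cardsT card_ord (leq_add (c1 D) (leqnn 2)).
- by apply: forward_single; rewrite cardsU1 cards1 inE ne.
- by apply: forward_single; rewrite cardsU1 cards1 inE ne.
- by apply: forward_single; rewrite cardsU1 cards1 inE ne.
by rewrite span_single //; apply/set0Pn; exists tt.
Qed.

Lemma card_copies_single (T : finType) (O : {set T * T * T}) :
  #|O| <= #|copies single_ed O|.
Proof.
pose h (t : T * T * T) : {ffun 'I_3 -> T} :=
  [ffun i => if i == inord 0 then t.1.1 else if i == inord 1 then t.1.2 else t.2].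
have hE t f : tmap (h t) (single_ed f) = t.
  case: t => [[x y] z]; rewrite /tmap !ffunE /= eqxx.
  by rewrite -!val_eqE /= !inordK.
have h_inj : injective h.
  by move=> t t' eqh; rewrite -(hE t tt) eqh hE.
rewrite -(card_imset O h_inj); apply: subset_leq_card.
apply/subsetP => _ /imsetP [t tO ->]; apply/copiesP; split=> [f | [] [] //].
by rewrite hE.
Qed.

End SingleEdge.

(** * Iterating the doubling *)

(* The threshold on [m] makes the clashing pairs, counted by [N * B], at most
   half of all pairs. *)
Lemma doubling_growth (m n N N' c B a p : nat) : 0 < n -> 0 < c ->
    m <= c * N * n ^ a -> c * (2 * B) * n ^ (a + p) <= m ->
    N ^ 2 <= n ^ p * (N' + N * B) ->
  m ^ 2 <= 2 * c ^ 2 * N' * n ^ (a.*2 + p).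
Proof.
move=> n0 c0 le_m ge_m le_N.
have na0 : 0 < n ^ a by rewrite expn_gt0 n0.
have leB : 2 * B * n ^ p <= N.
  rewrite -(leq_pmul2r na0) -(leq_pmul2l c0).
  by have := leq_trans ge_m le_m; rewrite expnD; lia.
have {}le_N : N ^ 2 <= 2 * N' * n ^ p.
  have : N * (2 * B * n ^ p) <= N ^ 2 by rewrite expnS expn1 leq_mul2l leB orbT.
  move: le_N; set x := n ^ p; rewrite mulnDr; nia.
apply: (@leq_trans ((c * N * n ^ a) ^ 2)); first by rewrite leq_sqr.
rewrite !expnMn -expnM muln2 expnD.
by have := leq_mul (leqnn (c ^ 2 * n ^ a.*2)) le_N; lia.
Qed.

(** [sunflower_hosts] started from a single edge and read contrapositively; the resulting [M] feeds
    [copies_amalgam]. *)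
Lemma doubling_few (V E : finType) (ed : E -> V * V * V) d S A b s e :
    doubling ed d S A b s -> #|E| <= e ->
  exists M, forall (T : finType) (O : {set T * T * T}),
    ~ hosts (e + d).+1 e O ->
    forall f (Phi : {set {ffun V -> T}}), Phi \subset copies ed O ->
      {in Phi &, forall phi psi : {ffun V -> T},
        {in S :|: tset (ed f), phi =1 psi}} -> #|Phi| <= M.
Proof.
move=> dbl le_e.
have [M MP] := sunflower_hosts (doubling_card dbl) (doubling_sparseS dbl)
  (doubling_bS_forward dbl) (doubling_span dbl) le_e #|E|.-1.
exists M => T O nhost f Phi PhiC eqPhi; rewrite leqNgt; apply/negP => ltM.
apply/nhost/(MP T O [set f] Phi) => //; last exact: ltnW.
- by apply/set0Pn; exists f; rewrite inE.
- by have := cardsC [set f]; rewrite cards1 => <-.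
by rewrite span1.
Qed.

(** Step [j] doubles a pattern with [2 ^ j] edges and excess [j + 2]. A sunflower of its copies
    would put [e] edges on [e + j + 3] vertices, provided [2 ^ j <= e]. The condition on [#|O|] is
    [m >= C' n^(2 - 2^(-j))] with the root cleared. *)
Lemma doubling_tower (e v k : nat) :
    (forall j, j < k -> 2 ^ j <= e /\ e + j + 3 <= v) ->
  exists (V E : finType) (ed : E -> V * V * V) (S A : {set V}) (b s : V)
      (c C : nat),
  [/\ doubling ed k.+2 S A b s, #|E| = 2 ^ k, 0 < c
    & forall (T : finType) (O : {set T * T * T}), ~ hosts v e O ->
      (forall j, j < k -> C * #|T| ^ (2 ^ j.+1).-1 <= #|O| ^ (2 ^ j)) ->
      #|O| ^ (2 ^ k) <= c * #|copies ed O| * #|T| ^ (2 ^ k.+1 - k.+2)].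
Proof.
elim: k => [_ | k IHk kP].
  exists 'I_3, unit, single_ed, [set inord 2], [set inord 0], (inord 1), (inord 2).
  exists 1, 0; split=> [||//| T O _ _]; first exact: doubling_single.
    by rewrite card_unit.
  by rewrite expn0 expn1 subnn expn0 muln1 mul1n card_copies_single.
have [j ltj | V [E [ed [S [A [b [s [c [C [dbl cE c0 grow]]]]]]]]]] := IHk.
  by apply: kP; rewrite ltnW.
have [le_e le_v] := kP k (ltnSn k).
have [|M few] := doubling_few dbl (e := e); first by rewrite cE.
exists (amalgam S), (E + E)%type, (@amalgam_ed V E ed S).
exists (right_copy S b |: left_copy S @: A), (left_copy S b |: right_copy S @: A).
exists (left_copy S s), (right_copy S b).
(* [2 * c ^ 2] comes from [doubling_growth]; the maximum keeps the thresholds of the earlier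
   steps. *)
exists (2 * c ^ 2), (maxn C (c * (2 * (#|E| * #|E| * M)))).
split; first exact: doubling_amalgam.
- by rewrite card_sum cE addnn -mul2n -expnS.
- by rewrite muln_gt0 expn_gt0 c0.
move=> T O nhost big.
have [T0 | T_gt0] := posnP #|T|.
  suff -> : #|O| = 0 by rewrite exp0n ?expn_gt0.
  apply/eqP; rewrite -leqn0 (leq_trans (max_card _)) //.
  by rewrite !card_prod T0 !muln0.
have lek : k.+2 <= 2 ^ k.+1 by apply: ltn_expl.
rewrite expnS mulnC expnM.
(* Squaring doubles the exponent of [#|T|], and Cauchy-Schwarz adds [#|S| = k + 1]. *)
have -> : 2 ^ k.+2 - k.+3 = (2 ^ k.+1 - k.+2).*2 + k.+1.
  by rewrite (expnS 2 k.+1) mul2n; lia.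
apply: (@doubling_growth _ _ #|copies ed O| _ _ (#|E| * #|E| * M)) => //.
- apply: grow => // j ltj; apply: leq_trans (big j _); last by rewrite ltnW.
  by rewrite leq_mul2r leq_maxl orbT.
- have -> : 2 ^ k.+1 - k.+2 + k.+1 = (2 ^ k.+1).-1 by lia.
  apply: leq_trans (big k (ltnSn k)).
  by rewrite leq_mul2r leq_maxr orbT.
have [cS] := doubling_cardS dbl; rewrite -cS.
apply: copies_amalgam; apply: few => host; apply/nhost/(hostsW _ host); lia.
Qed.

(** After [K] doublings the pattern has more than [e] edges, so a single copy suffices: [e] edges
    are listed from the [K + 2] vertices of [b |: S]. The bound [2 ^ K <= 2 * e] keeps every pattern
    that is doubled within [e] edges. *)
Lemma dense_hosts (e K : nat) : 0 < e -> e < 2 ^ K -> 2 ^ K <= 2 * e ->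
  exists C, forall (T : finType) (O : {set T * T * T}), 0 < #|O| ->
    (forall j, j < K -> C * #|T| ^ (2 ^ j.+1).-1 <= #|O| ^ (2 ^ j)) ->
    hosts (e + K + 2) e O.
Proof.
move=> e0 ltK leK; have [j ltj|] := @doubling_tower e (e + K + 2) K.
  split; last by lia.
  by rewrite -(leq_pmul2l (isT : 0 < 2)) -expnS (leq_trans _ leK) ?leq_exp2l.
move=> V [E [ed [S [A [b [s [c [C [dbl cE c0 grow]]]]]]]]].
exists C => T O O0 big.
have hostsP : (hosts (e + K + 2) e O) \/ ~ (hosts (e + K + 2) e O).
  pose B := [exists U : {set T},
    (#|U| <= e + K + 2) && (e <= #|[set t in O | tset t \subset U]|)].
  case: (boolP B) => [/existsP [U /andP [? ?]] | nB]; first by left; exists U.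
  by right => -[U [? ?]]; case/existsP: nB; exists U; apply/andP.
case: hostsP => // nhost; have := grow T O nhost big.
have [-> | [phi phiC] _] := set_0Vmem (copies ed O).
  by rewrite cards0 muln0 mul0n leqn0 expn_eq0 -leqn0 leqNgt O0.
apply: hostsW (copy_hosts phiC (doubling_bS_forward dbl) _).
  by rewrite cardsU1 (doubling_bS dbl) add1n (doubling_cardS dbl); lia.
by rewrite cE ltnW.
Qed.

(** * From ordered triples to 3-sets *)

Section Orientation.
Variables (T : finType) (H : {set {set T}}).

(* Picks one ordering of the vertices of each edge. *)
Definition orientation : {set T * T * T} :=
  [set t | (tset t \in H) && ([pick t' | tset t' == tset t] == Some t)].

Lemma tset_orientation_inj : {in orientation &, injective (@tset T)}.
Proof.
move=> t t'; rewrite !inE => /andP [_ /eqP pt] /andP [_ /eqP pt'] eq_t.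
by move: pt; rewrite eq_t pt' => -[].
Qed.

Lemma card_orientation : uniform3 H -> #|H| <= #|orientation|.
Proof.
move=> /forall_inP H3; rewrite -(card_in_imset tset_orientation_inj).
apply: subset_leq_card; apply/subsetP => h hH.
have [t th] : exists t : T * T * T, tset t = h.
  have := eqP (H3 h hH); have := mem_enum h; rewrite cardE.
  case: (enum h) => [|x [|y [|z [|]]]] // he _; exists (x, y, z).
  by apply/setP => v; rewrite -he !inE orbA.
have [t' t'h pt'] : exists2 t', tset t' = h & [pick t' | tset t' == h] = Some t'.
  case: pickP => [t' /eqP t'h | /(_ t)]; first by exists t'.
  by rewrite th eqxx.
by apply/imsetP; exists t'; rewrite ?inE t'h ?hH // pt' eqxx.
Qed.

Lemma hosts_orientation v e : hosts v e orientation ->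
  exists U : {set T}, #|U| <= v /\ e <= #|[set h in H | h \subset U]|.
Proof.
case=> U [Uv Ue]; exists U; split=> //; apply: leq_trans Ue _.
rewrite -(card_in_imset (f := @tset T)); last first.
  move=> t t' /setIdP [tO _] /setIdP [t'O _]; exact: tset_orientation_inj.
apply: subset_leq_card; apply/subsetP => _ /imsetP [t /setIdP [tO tU] ->].
by rewrite inE tU andbT; move: tO; rewrite inE => /andP [].
Qed.

End Orientation.

(** The number of doublings is the truncated logarithm plus one, the only [K] with
    [e < 2 ^ K <= 2 * e]; this gives the additive constant 3. *)
Lemma dense_configuration (e : nat) : 0 < e ->
  exists C, forall (T : finType) (H : {set {set T}}), uniform3 H -> H != set0 ->
    (forall j, j <= trunc_log 2 e ->
       C * #|T| ^ (2 ^ j.+1).-1 <= #|H| ^ (2 ^ j)) ->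
    exists U : {set T}, #|U| <= e + trunc_log 2 e + 3 /\
      e <= #|[set h in H | h \subset U]|.
Proof.
move=> e0; have /andP [le_e lt_e] := trunc_log_bounds (isT : 1 < 2) e0.
have [|C CP] := dense_hosts e0 lt_e; first by rewrite expnS leq_mul2l le_e.
exists C => T H H3 Hn0 big; have leO := card_orientation H3.
apply/hosts_orientation.
have -> : e + trunc_log 2 e + 3 = e + (trunc_log 2 e).+1 + 2 by lia.
apply: CP => [|j ltj]; first by rewrite (leq_trans _ leO) // card_gt0.
by apply: leq_trans (big j ltj) _; rewrite leq_exp2r ?expn_gt0.
Qed.

(* Real exponents and the asymptotic bound *)
From HB Require Import structures.
From mathcomp Require Import all_boot all_order all_algebra.
From mathcomp Require Import all_classical all_reals all_analysis.
Import Order.TTheory GRing.Theory Num.Theory.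
Import numFieldNormedType.Exports.

Local Open Scope classical_set_scope.
Local Open Scope ring_scope.

(** The power [2 ^ j] turns the exponent into [2 ^ (j + 1) - 2 ^ (j - k)], which is at least
    [2 ^ (j + 1) - 1] as [j <= k]. Since [C.+1] is at least 1, its powers stay above [C]. *)
Lemma powR_sparsity (R : realType) (k j C n m : nat) :
    (j <= k)%N -> (0 < n)%N ->
    C.+1%:R * n%:R `^ (2 - (2 ^+ k)^-1) < m%:R :> R ->
  (C * n ^ (2 ^ j.+1).-1 <= m ^ (2 ^ j))%N.
Proof.
move=> le_jk n_gt0 /ltW le_m; rewrite -(ler_nat R) natrM !natrX.
have n1 : 1 <= n%:R :> R by rewrite ler1n.
have C1 : 1 <= C.+1%:R :> R by rewrite ler1n.
have pos : 0 <= C.+1%:R * n%:R `^ (2 - (2 ^+ k)^-1) :> R.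
  by rewrite mulr_ge0 ?powR_ge0.
have le_mX : (C.+1%:R * n%:R `^ (2 - (2 ^+ k)^-1)) ^+ (2 ^ j) <= m%:R ^+ (2 ^ j) :> R.
  by rewrite lerXn2r ?nnegrE.
apply: le_trans le_mX; rewrite exprMn; apply: ler_pM => //.
- apply: (@le_trans _ _ C.+1%:R); first by rewrite ler_nat.
  by rewrite ler_eXnr ?expn_gt0.
rewrite -[leLHS]powR_mulrn // -[leRHS]powR_mulrn ?powR_ge0 // -powRrM ler_powR //.
have -> : (2 ^ j.+1).-1%:R = 2 * 2 ^+ j - 1 :> R.
  by rewrite -subn1 natrB ?expn_gt0 // natrX exprS.
rewrite natrX mulrBl lerB // mulrC ler_pdivrMr ?exprn_gt0 // mul1r.
by rewrite ler_eXn2l // ltr1n.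
Qed.

Theorem theorem1p3 (R : realType) (e : nat) (he : (3 <= e)%N) :
  exists eps : R, 0 < eps /\
    (fun n : nat => (fBES n (e + trunc_log 2 e + 38) e)%:R : R^o) =O_\oo
      (fun n : nat => n%:R `^ (2 - eps) : R^o) /\
    exists C : R, forall (T : finType) (E : {set {set T}}),
      uniform3 E ->
      C * #|T|%:R `^ (2 - eps) < #|E|%:R ->
      exists S : {set T},
        (#|S| <= e + trunc_log 2 e + 38)%N /\
        (e <= #|[set h in E | h \subset S]%SET|)%N.
Proof.
have [|C CP] := dense_configuration (e := e); first by rewrite (leq_trans _ he).
(* The last doubling, [j = trunc_log 2 e], sets the strongest threshold. *)
pose eps : R := (2 ^+ trunc_log 2 e)^-1.
have dense (T : finType) (E : {set {set T}}) : uniform3 E ->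
    C.+1%:R * #|T|%:R `^ (2 - eps) < #|E|%:R ->
    exists S : {set T}, (#|S| <= e + trunc_log 2 e + 38)%N /\
      (e <= #|[set h in E | h \subset S]%SET|)%N.
  move=> E3 ltE; have E0 : (0 < #|E|)%N.
    by rewrite -(ltr_nat R) (le_lt_trans _ ltE) // mulr_ge0 ?powR_ge0.
  have /card_gt0P [h hE] := E0.
  have T0 : (0 < #|T|)%N.
    rewrite (leq_trans _ (max_card (mem h))) //.
    by move/forall_inP: E3 => /(_ h hE) /eqP ->.
  have [||U [Uv Ue]] := CP T E E3; first by rewrite -card_gt0.
    by move=> j le_j; apply: powR_sparsity le_j T0 ltE.
  by exists U; split=> //; rewrite (leq_trans Uv) // leq_add2l.
exists eps; split; first by rewrite /eps invr_gt0 exprn_gt0.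
split; last by exists C.+1%:R.
apply/eqO_exP; exists C.+1%:R; first exact: ltr0Sn.
(* The bound holds for every [n]: a hypergraph above it has a configuration and is not counted by
   [fBES]. *)
apply: nearW => n /=; rewrite !ger0_norm ?powR_ge0 //.
rewrite /fBES; elim/big_ind: _ => [|x y lex ley|E /andP [E3 nE]].
- by rewrite mulr_ge0 ?powR_ge0.
- by rewrite /maxn; case: ifP.
rewrite leNgt; apply/negP; rewrite -{1}(card_ord n) => /(dense _ _ E3) [S [Sv Se]].
case/negP: nE; apply/existsP; exists S; apply/existsP.
exists [set h in E | h \subset S]%SET; rewrite Sv Se !andbT; apply/andP; split.
  by apply/fintype.subsetP => h; rewrite inE => /andP [].
by apply/fintype.subsetP => h; rewrite !inE => /andP [].
Qed.
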